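(* For all integers $n\ge 1$ and $t\ge 1$, the $t$-toed caterpillar whose spine has $n+2$ vertices is odd prime.
   Context: All graphs are finite and simple. A graph $G$ of order $N$ is odd prime if there is a bijection $\ell:V(G)\to\{1,3,\ldots,2N-1\}$ with $\gcd(\ell(u),\ell(v))=1$ for every edge $uv$. The $t$-toed caterpillar with spine of $n+2$ vertices has spine path $u,v_1,\ldots,v_n,w$, and each interior spine vertex $v_i$ is additionally adjacent to $t$ leaves $x_{i,1},\ldots,x_{i,t}$ (so every interior spine vertex has degree $t+2$); it has $n(t+1)+2$ vertices. *)

(* Defs.v *)
From mathcomp Require Import all_boot.
Set Implicit Arguments. Unset Strict Implicit. Unset Printing Implicit Defensive.

Definition simple_graph (V : finType) (adj : rel V) : Prop :=
  (forall x y, adj x y = adj y x) /\ (forall x, ~~ adj x x).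

(* Odd prime labeling: a bijection l : V -> {1,3,...,2N-1} (N = #|V|) with
   gcd (l u) (l v) = 1 on every edge.  A map into that N-element set is a
   bijection iff it is injective. *)
Definition odd_prime_labeling (V : finType) (adj : rel V) (l : V -> nat) : Prop :=
  injective l /\
  (forall x, odd (l x) /\ l x < 2 * #|V|) /\
  (forall x y, adj x y -> coprime (l x) (l y)).

Definition odd_prime (V : finType) (adj : rel V) : Prop :=
  exists l : V -> nat, odd_prime_labeling adj l.

(* Vertices of the t-toed caterpillar with spine u, v_1, ..., v_n, w:
   inl false = u, inl true = w,
   inr (i, None)   = v_{i+1}        (i : 'I_n),
   inr (i, Some j) = x_{i+1, j+1}   (j : 'I_t). *)
Definition cat_vertex (n t : nat) : finType := (bool + ('I_n * option 'I_t))%type.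

Definition cat_arc (n t : nat) (a b : cat_vertex n t) : bool :=
  match a, b with
  | inl false, inr (i, None) => val i == 0
  | inr (i, None), inl true => val i == n.-1
  | inr (i, None), inr (k, None) => val k == (val i).+1
  | inr (i, None), inr (k, Some _) => i == k
  | _, _ => false
  end.

Definition caterpillar_adj (n t : nat) : rel (cat_vertex n t) :=
  fun a b => cat_arc a b || cat_arc b a.

Lemma caterpillar_simple (n t : nat) : simple_graph (@caterpillar_adj n t).
Proof.
split; first by move=> x y; rewrite /caterpillar_adj orbC.
move=> [[]|[i [j|]]]; rewrite /caterpillar_adj /cat_arc //= orbb.
by apply/negP => /eqP H; move: (n_Sn i); rewrite -H.
Qed.

(* Main.v *)
(* Write the labels as [2a+1] with [a < N := n(t+1)+2], and let the conflicts of
   a label be the other labels with which it has a common factor.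

   For [t <= 10], cut the labels after 1 into blocks of [t+1] consecutive odd
   numbers, one per spine vertex, with [u] labelled 1 and [w] labelled [2N-1].
   In each block the spine vertex gets a label coprime to 3 (or to 105), at a
   place whose distances to the rest of the block and to the previous spine
   label are products of 2 and 3 (or 2, 3, 5, 7).

   For [t >= 11], it suffices to find distinct spine labels [s_0 = 1], [s_1], ...,
   consecutively coprime, such that [s_j] has at most [t * j] conflicts: serve
   the spine vertices from the last to the first, each taking any [t] remaining
   labels coprime to it. After 1, take the primes [>= N / 11], with at most 11
   conflicts each. If these run out then Chebyshev's bound makes [N] at least
   exponential in [t] and bounds [N / (t * j)] by a small multiple of [log N];
   then [s_j] is picked among the labels with at most [N / D] conflicts for a
   suitable [D >= 8]. There are at least [7N / 4D] of those: the labels without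
   prime factors [<= D] have density at least [(128/35) / D], and as the sum of
   [1 / p ^ 2] over odd [p > D] is at most [1 / 2D], at most about half of them
   have more than [N / D] conflicts. *)
Require Import Defs.
From mathcomp Require Import all_boot.
From mathcomp Require Import zify.
Set Implicit Arguments. Unset Strict Implicit. Unset Printing Implicit Defensive.

(** * At most ten toes *)

Lemma odd_prime_of_arcs n t (l : cat_vertex n t -> nat) :
  injective l -> (forall x, l x < n * t.+1 + 2) ->
  (forall x y, cat_arc x y -> coprime (l x).*2.+1 (l y).*2.+1) ->
  odd_prime (@caterpillar_adj n t).
Proof.
move=> l_inj l_lt l_cop; exists (fun x => (l x).*2.+1); split; last split.
- by move=> x y [/double_inj /l_inj].
- move=> x; split; first by rewrite /= odd_double.
  have -> : #|cat_vertex n t| = n * t.+1 + 2.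
    by rewrite card_sum card_bool card_prod card_option !card_ord addnC.
  by have := l_lt x; lia.
- by move=> x y /orP[/l_cop // | /l_cop]; rewrite coprime_sym.
Qed.

Definition smooth (m d : nat) := (0 < d) && all (fun p => (p == 2) || (p %| m)) (primes d).

(** The two odd numbers differ by [2 * d], whose odd prime factors all divide [m] and so cannot
    divide [2a+1]. *)
Lemma smooth_coprime m d a b : smooth m d -> coprime a.*2.+1 m ->
  b = a + d \/ a = b + d -> coprime a.*2.+1 b.*2.+1.
Proof.
case/andP=> d_gt0 /allP sm_d cop_m ab.
have -> : coprime a.*2.+1 b.*2.+1 = coprime a.*2.+1 (2 * d).
  case: ab => ->; rewrite /coprime doubleD -addSn mul2n ?gcdnDl //.
  by rewrite gcdnC gcdnDl [in RHS]gcdnC gcdnDr gcdnC.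
rewrite coprimeMr coprimen2 /= odd_double /=.
rewrite coprime_has_primes //; apply/hasPn => p p_d.
apply/negP => /=; rewrite mem_primes => /and3P[p_pr _ p_a].
have /orP[/eqP p2|p_m] := sm_d p p_d.
  by move: p_a; rewrite p2 dvdn2 /= odd_double.
have := coprime_dvdr p_m cop_m; rewrite coprime_sym prime_coprime //.
by rewrite p_a.
Qed.

(* Candidate positions for the spine vertex in a block of [k] consecutive odd
   numbers. Position [k] is the number following the block, which is the label
   of [w] for the last block. *)
Definition block_positions (m k : nat) : seq nat :=
  [seq p <- iota 0 k | all (fun j => (j == p) || smooth m (maxn j p - minn j p)) (iota 0 k.+1)].

(** Here [a] is the index of the first label of the block and [p] the spine position in the previous
    block, so [k + p' - p] is the index distance between the two spine labels. *)
Definition block_next (m k a p : nat) : seq nat :=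
  [seq p' <- block_positions m k | coprime (a + p').*2.+1 m && smooth m (k + p' - p)].

(* The first block starts at 3, and the start of a block only matters mod [m]. *)
Definition block_check (m k : nat) : bool :=
  all (fun a => all (fun p => block_next m k a p != [::]) (block_positions m k)) (iota 0 m)
  && (block_positions m k != [::]).

(** These are the block sizes [t + 1] for [t] from 1 to 4 and from 5 to 10. *)
Lemma small_block_checks :
  all (block_check 3) [:: 2; 3; 4; 5] &&
  all (block_check 105) [:: 6; 7; 8; 9; 10; 11].
Proof. by vm_compute. Qed.

(** Block [i] starts at index [1 + i * k]. The first block has no predecessor; some candidate
    position stands in for it, so that [block_next] applies uniformly. *)
Fixpoint spine_position (m k i : nat) : nat :=
  if i is i'.+1 then head 0 (block_next m k (1 + i * k) (spine_position m k i'))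
  else head 0 (block_next m k 1 (head 0 (block_positions m k))).

Lemma mem_head_neq0 (s : seq nat) : s != [::] -> head 0 s \in s.
Proof. by case: s => // x s _; rewrite mem_head. Qed.

Lemma block_nextP m k a p : block_check m k -> 0 < m ->
  p \in block_positions m k ->
  head 0 (block_next m k a p) \in block_next m k a p.
Proof.
move=> m_check m_gt0 p_k; apply: mem_head_neq0.
have -> : block_next m k a p = block_next m k (a %% m) p.
  rewrite /block_next; apply: eq_filter => p'; congr (_ && _).
  have -> : (a + p').*2.+1 = (a %/ m).*2 * m + (a %% m + p').*2.+1.
    by rewrite {1}(divn_eq a m); lia.
  by rewrite coprime_sym /coprime gcdnMDl gcdnC.
case/andP: m_check => /allP /(_ (a %% m)) + _.
rewrite mem_iota add0n ltn_mod m_gt0 => /(_ isT) /allP; exact.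
Qed.

Lemma spine_positionP m k i : block_check m k -> 0 < m ->
  spine_position m k i \in block_positions m k /\
  coprime (1 + i * k + spine_position m k i).*2.+1 m.
Proof.
move=> m_check m_gt0.
have next a p : p \in block_positions m k ->
    head 0 (block_next m k a p) \in block_positions m k /\
    coprime (a + head 0 (block_next m k a p)).*2.+1 m.
  by move=> /(block_nextP a m_check m_gt0); rewrite mem_filter => /andP[/andP[]].
elim: i => [|i [IH _]]; last exact: (next (1 + i.+1 * k)).
by case/andP: m_check => _ /mem_head_neq0 /(next 1).
Qed.

Lemma spine_position_step m k i : block_check m k -> 0 < m ->
  smooth m (k + spine_position m k i.+1 - spine_position m k i).
Proof.
move=> m_check m_gt0.
have [/(block_nextP (1 + i.+1 * k) m_check m_gt0) + _] := spine_positionP i m_check m_gt0.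
by rewrite mem_filter => /andP[/andP[]].
Qed.

Lemma spine_position_lt m k i : block_check m k -> 0 < m -> spine_position m k i < k.
Proof.
move=> m_check m_gt0; have [] := spine_positionP i m_check m_gt0.
by rewrite mem_filter mem_iota => /andP[].
Qed.

Lemma block_coprime m k i j : block_check m k -> 0 < m ->
  j <= k -> j != spine_position m k i ->
  coprime (1 + i * k + spine_position m k i).*2.+1 (1 + i * k + j).*2.+1.
Proof.
move=> m_check m_gt0 j_le j_neq; have [] := spine_positionP i m_check m_gt0.
rewrite mem_filter => /andP[/allP /(_ j) + _]; rewrite mem_iota /= => /(_ j_le).
rewrite (negbTE j_neq) /= => sm cop.
apply: (smooth_coprime sm cop); lia.
Qed.

Lemma block_spine_coprime m k i : block_check m k -> 0 < m ->
  coprime (1 + i * k + spine_position m k i).*2.+1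
          (1 + i.+1 * k + spine_position m k i.+1).*2.+1.
Proof.
move=> m_check m_gt0; have [_ cop] := spine_positionP i m_check m_gt0.
apply: (smooth_coprime (spine_position_step i m_check m_gt0) cop).
by have := spine_position_lt i m_check m_gt0; lia.
Qed.

Lemma odd_prime_of_blocks m n t : 0 < n -> 0 < m -> block_check m t.+1 ->
  odd_prime (@caterpillar_adj n t).
Proof.
move=> n_gt0 m_gt0 chk; pose k := t.+1; pose p := spine_position m k.
have p_lt i : p i < k by exact: spine_position_lt.
have bump_lt i (j : 'I_t) : bump (p i) j < k by rewrite /bump /k; have := ltn_ord j; lia.
have block_inj i i' j j' : j < k -> j' < k -> 1 + i * k + j = 1 + i' * k + j' -> i = i' /\ j = j'.
  move=> j_k j'_k; rewrite -!addnA => /addnI e.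
  have := congr1 (divn^~ k) e; have := congr1 (modn^~ k) e.
  by rewrite !modnMDl !divnMDl // !divn_small // !modn_small // !addn0.
have block_lt (i : 'I_n) j : j < k -> 1 + i * k + j < n * k + 1.
  by move=> j_k; have := ltn_ord i; rewrite /k in j_k *; nia.
have block_neq (i : 'I_n) j : j < k -> 1 + i * k + j = n * k + 1 -> False.
  by move=> /(block_lt i) + e; rewrite e ltnn.
(* [bump (p i)] runs through the positions of block [i] other than [p i]. *)
pose l (x : cat_vertex n t) := match x with
  | inl false => 0
  | inl true => n * k + 1
  | inr (i, None) => 1 + i * k + p i
  | inr (i, Some j) => 1 + i * k + bump (p i) j
  end.
apply: (@odd_prime_of_arcs n t l).
- move=> [[]|[i [j|]]] [[]|[i' [j'|]]] //=; rewrite -/k.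
  + lia.
  + by move/esym/(block_neq _ _ (bump_lt i' j')).
  + by move/esym/(block_neq _ _ (p_lt i')).
  + lia.
  + by move/(block_neq _ _ (bump_lt i j)).
  + move=> /(block_inj _ _ _ _ (bump_lt i j) (bump_lt i' j'))[ii' /=].
    have {ii'} -> : i = i' by exact: val_inj.
    by move/(can_inj (bumpK _)) => jj'; congr (inr (_, Some _)); exact: val_inj.
  + move=> /(block_inj _ _ _ _ (bump_lt i j) (p_lt i'))[ii' /=].
    by have -> : i = i' by [exact: val_inj]; move/eqP; rewrite eq_sym (negbTE (neq_bump _ _)).
  + by move/(block_neq _ _ (p_lt i)).
  + move=> /(block_inj _ _ _ _ (p_lt i) (bump_lt i' j'))[ii' /=].
    by have -> : i = i' by [exact: val_inj]; move/eqP; rewrite (negbTE (neq_bump _ _)).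
  + move=> /(block_inj _ _ _ _ (p_lt i) (p_lt i'))[ii' _].
    by have -> : i = i' by [exact: val_inj].
- move=> [[]|[i [j|]]]; rewrite /l -/k; first by lia.
  + lia.
  + by apply: (leq_trans (block_lt i _ (bump_lt i j))); rewrite leq_add2l.
  + by apply: (leq_trans (block_lt i _ (p_lt i))); rewrite leq_add2l.
- move=> [[]|[i [j|]]] [[]|[i' [j'|]]] //=.
  + by rewrite coprime1n.
  + move=> /eqP i_n; rewrite -/k.
    have -> : (n * k + 1) = 1 + i * k + k by rewrite i_n; nia.
    apply: (block_coprime chk) => //.
    by rewrite eq_sym; exact: (negbT (ltn_eqF (p_lt i))).
  + move=> /eqP <-; apply: (block_coprime chk) => //.
      exact: ltnW (bump_lt _ _).
    by rewrite eq_sym neq_bump.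
  + by move=> /eqP ->; exact: block_spine_coprime.
Qed.

Lemma odd_prime_small n t : 0 < n -> 0 < t <= 10 -> odd_prime (@caterpillar_adj n t).
Proof.
move=> n_gt0 t_le; case/andP: small_block_checks => /allP c3 /allP c105.
have [t_le4|t_gt4] := leqP t 4.
  by apply: (@odd_prime_of_blocks 3) => //; apply: c3; rewrite !inE; lia.
by apply: (@odd_prime_of_blocks 105) => //; apply: c105; rewrite !inE; lia.
Qed.

(** * The greedy distribution of the leaves *)

Definition cop (a b : nat) : bool := coprime a.*2.+1 b.*2.+1.

Definition conf (N a : nat) : nat :=
  count (fun b => (b != a) && ~~ cop a b) (iota 0 N).

(** Since [a] is outside the pool, every pool label not coprime to it is one of its conflicts. *)
Lemma conf_pool N a (pool : seq nat) : uniq pool ->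
  {in pool, forall b, b < N} -> a \notin pool ->
  size pool <= count (cop a) pool + conf N a.
Proof.
move=> pool_u pool_lt a_pool; rewrite -(count_predC (cop a) pool) leq_add2l.
rewrite /conf -!size_filter; apply: uniq_leq_size; first exact: filter_uniq.
move=> b; rewrite !mem_filter /= mem_iota add0n leq0n => /andP[-> b_pool].
by rewrite pool_lt //= !andbT; apply: contraNneq a_pool => <-.
Qed.

(* The spine is served from its last vertex, whose label may have the most
   conflicts, to its first, so that the pool shrinks no faster than the
   bound on the conflicts. *)
Lemma greedy_leaves N t (s pool : seq nat) : uniq pool ->
  {in pool, forall b, b < N} -> {in s, forall a, a \notin pool} ->
  (forall i, i < size s -> conf N (nth 0 s i) <= t * i) ->
  size pool = t * size s + 1 ->
  exists r L, [/\ perm_eq pool (r :: L), size L = size s * t &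
    forall i j, i < size s -> j < t -> cop (nth 0 s i) (nth 0 L (i * t + j))].
Proof.
elim/last_ind: s pool => [|s a IH] pool pool_u pool_lt s_pool s_conf.
  rewrite muln0; case: pool {pool_u pool_lt s_pool} => [|r [|]] // _.
  by exists r, [::].
rewrite size_rcons => pool_size.
pose good := [seq b <- pool | cop a b].
(* The pool has [t * (size s + 1) + 1] labels, of which at most [t * size s] conflict with [a]. *)
have t_good : t <= size good.
  have a_pool : a \notin pool by apply: s_pool; rewrite mem_rcons mem_head.
  have := conf_pool pool_u pool_lt a_pool; rewrite -size_filter -/good pool_size.
  have := s_conf (size s); rewrite size_rcons ltnSn nth_rcons ltnn eqxx => /(_ isT).
  by rewrite mulnS; lia.
pose T := take t good; pose rest := [seq b <- pool | b \notin T].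
have T_size : size T = t by rewrite size_take_min; apply/minn_idPl.
have T_u : uniq T by apply: take_uniq; exact: filter_uniq.
have T_good b : b \in T -> cop a b && (b \in pool).
  by move/mem_take; rewrite mem_filter.
have pool_perm : perm_eq pool (rest ++ T).
  apply: uniq_perm => //.
    rewrite cat_uniq filter_uniq // T_u andbT; apply/hasPn => b b_T.
    by rewrite mem_filter /= b_T.
  move=> b; rewrite mem_cat mem_filter; case: (boolP (b \in T)) => [/T_good /andP[_ ->]|] //=.
  by rewrite orbF.
have rest_size : size rest = t * size s + 1.
  have := perm_size pool_perm; rewrite size_cat T_size pool_size mulnS; lia.
have rest_sub b : b \in rest -> b \in pool by rewrite mem_filter => /andP[].
have [||||r [L [rest_perm L_size L_cop]]] := IH rest _ _ _ _ rest_size.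
- exact: filter_uniq.
- by move=> b /rest_sub /pool_lt.
- move=> b b_s; apply: contra (s_pool b _); first exact: rest_sub.
  by rewrite mem_rcons inE b_s orbT.
- move=> i i_s; have := s_conf i; rewrite size_rcons nth_rcons i_s; apply.
  exact: leqW.
exists r, (L ++ T); split.
- by apply: (perm_trans pool_perm); rewrite -cat_cons perm_cat2r.
- by rewrite size_cat L_size T_size mulSn addnC.
- move=> i j i_s j_t; rewrite nth_rcons nth_cat L_size.
  have [i_lt|i_gt|->] := ltngtP i (size s); last 1 first.
  + rewrite ltnNge leq_addr /= addKn; have /T_good : nth 0 T j \in T by rewrite mem_nth ?T_size.
    by case/andP.
  + have -> : i * t + j < size s * t by nia.
    exact: L_cop.
  + by lia.
Qed.

(** As [v_1] is labelled 1, any label suits [u]. So the label of [w] is set aside first, the leaves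
    are served greedily, and [u] takes the one label left over. *)
Lemma odd_prime_of_spine n t (s : seq nat) : 0 < n -> size s = n -> uniq s ->
  nth 0 s 0 = 0 -> {in s, forall a, a < n * t.+1 + 2} ->
  (forall i, i.+1 < n -> cop (nth 0 s i) (nth 0 s i.+1)) ->
  (forall i, i < n -> conf (n * t.+1 + 2) (nth 0 s i) <= t * i) ->
  odd_prime (@caterpillar_adj n t).
Proof.
move=> n_gt0 s_size s_u s0 s_lt s_cop s_conf; set N := n * t.+1 + 2 in s_lt s_conf.
pose pool := [seq b <- iota 0 N | b \notin s].
have pool_u : uniq pool by rewrite filter_uniq ?iota_uniq.
have pool_lt b : b \in pool -> b < N by rewrite mem_filter mem_iota add0n => /andP[].
have all_perm : perm_eq (iota 0 N) (s ++ pool).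
  apply: uniq_perm; first exact: iota_uniq.
    rewrite cat_uniq s_u pool_u andbT; apply/hasPn => b.
    by rewrite mem_filter => /andP[].
  move=> b; rewrite mem_cat mem_filter mem_iota add0n leq0n /=.
  by case: (boolP (b \in s)) => [/s_lt ->|].
have pool_size : size pool = t * n + 2.
  have := perm_size all_perm; rewrite size_iota size_cat s_size /N; lia.
pose z := nth 0 s n.-1.
(* The pool has [t * n + 2] labels, and [z] at most [t * (n - 1)] conflicts. *)
have /hasP[w w_pool z_w] : has (cop z) pool.
  rewrite has_count; have z_pool : z \notin pool.
    by rewrite mem_filter mem_nth ?s_size //; lia.
  have := conf_pool pool_u pool_lt z_pool; rewrite pool_size.
  have := s_conf n.-1; rewrite -/z; nia.
have w_perm := perm_to_rem w_pool.
have [|||||r [L [rem_perm L_size L_cop]]] := @greedy_leaves N t s (rem w pool).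
- exact: rem_uniq.
- by move=> b /mem_rem /pool_lt.
- move=> b b_s; apply: contraL b_s => /mem_rem; by rewrite mem_filter => /andP[].
- by rewrite s_size.
- by rewrite size_rem // pool_size s_size; lia.
rewrite s_size in L_size L_cop.
pose A := w :: r :: s ++ L.
have A_perm : perm_eq (iota 0 N) A.
  apply: (perm_trans all_perm); rewrite perm_sym (perm_catCA [:: w; r] s L) /=.
  rewrite perm_cat2l perm_sym; apply: (perm_trans w_perm).
  by rewrite perm_cons.
have A_u : uniq A by rewrite -(perm_uniq A_perm) iota_uniq.
have A_size : size A = N by rewrite -(perm_size A_perm) size_iota.
(* Positions in [A]: 0 for the vertex [w], 1 for [u], then the spine, then the leaves. *)
pose pos (x : cat_vertex n t) := match x with
  | inl b => ~~ b : nat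
  | inr (i, None) => 2 + i
  | inr (i, Some j) => 2 + (n + (i * t + j))
  end.
have pos_lt x : pos x < N.
  case: x => [[]|[i [j|]]] /=; rewrite /N.
  + lia.
  + lia.
  + by have := ltn_ord i; have := ltn_ord j; nia.
  + by have := ltn_ord i; nia.
have nth_s i : i < n -> nth 0 A (2 + i) = nth 0 s i.
  by move=> i_n; rewrite /A /= nth_cat s_size i_n.
have nth_L m : nth 0 A (2 + (n + m)) = nth 0 L m.
  by rewrite /A /= nth_cat s_size ltnNge leq_addr /= add0n addKn.
apply: (@odd_prime_of_arcs n t (fun x => nth 0 A (pos x))).
- move=> x y /eqP; rewrite nth_uniq ?A_size ?pos_lt // => /eqP.
  case: x y => [[]|[i [j|]]] [[]|[i' [j'|]]] //=.
  + rewrite !add2n => -[/addnI e]; have := congr1 (divn^~ t) e; have := congr1 (modn^~ t) e.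
    have t_gt0 : 0 < t by exact: leq_ltn_trans (ltn_ord j).
    rewrite !modnMDl !divnMDl // !divn_small // !modn_small // !addn0.
    by move=> /val_inj -> /val_inj ->.
  + by have := ltn_ord i'; lia.
  + by have := ltn_ord i; lia.
  + by rewrite !add2n => -[/val_inj ->].
- by move=> x; rewrite -/N; have := mem_nth 0 (_ : pos x < size A);
    rewrite -(perm_mem A_perm) mem_iota A_size add0n => /(_ (pos_lt x)).
- move=> [[]|[i [j|]]] [[]|[i' [j'|]]] //; rewrite /cat_arc /pos.
  + by move=> /eqP i0; rewrite nth_s // i0 s0 coprimen1.
  + by move=> /eqP i_n; rewrite nth_s // i_n.
  + by move=> /eqP <-; rewrite nth_s // nth_L; exact: L_cop.
  + move=> /eqP i_i; rewrite !nth_s // i_i; apply: s_cop; rewrite -i_i.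
    exact: ltn_ord.
Qed.

(** * Counting labels with few conflicts *)

Definition rough_count (W L : nat) : nat := \sum_(0 <= a < L) coprime a.*2.+1 W.

(** For odd [W], the map [a -> 2a+1] permutes the residues mod [W]. *)
Lemma rough_count_period W : odd W -> rough_count W W = totient W.
Proof.
move=> W_odd; have W_gt0 : 0 < W by case: W W_odd.
rewrite totient_count_coprime /rough_count !big_mkord.
pose f (a : 'I_W) : 'I_W := Ordinal (ltn_pmod a.*2.+1 W_gt0).
have f_inj : injective f.
  move=> a b /(congr1 val) /= /eqP e; apply: val_inj; apply/eqP.
  move: e; rewrite -[X in X %% _]addn1 -[X in _ == X %% _]addn1 eqn_modDr.
  rewrite -!muln2; wlog a_b : a b / a <= b.
    by move=> H; case/orP: (leq_total a b) => /H // H'; rewrite eq_sym => /H'; rewrite eq_sym.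
  rewrite eq_sym eqn_mod_dvd; last by rewrite leq_mul2r a_b orbT.
  rewrite -mulnBl Gauss_dvdl ?coprimen2 // => W_ba.
  have ba_lt : b - a < W by apply: leq_ltn_trans (ltn_ord b); rewrite leq_subr.
  have : b - a = 0 by apply/eqP; rewrite -leqn0 leqNgt; apply/negP => /dvdn_leq /(_ W_ba); lia.
  by move=> ba0; apply/eqP => /=; lia.
rewrite [RHS](reindex_inj f_inj) /=; apply: eq_bigr => a _.
by rewrite coprime_modr coprime_sym.
Qed.

Lemma rough_countD W L : odd W -> rough_count W (L + W) = rough_count W L + totient W.
Proof.
move=> W_odd; rewrite {1}/rough_count (big_cat_nat _ (n := W)) ?leq_addl //=.
rewrite -/(rough_count W W) rough_count_period // addnC; congr (_ + _).
rewrite -{1}[W]add0n big_addn addnK; apply: eq_bigr => a _; congr nat_of_bool.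
by rewrite coprime_sym doubleD -addSn -[W.*2]mul2n /coprime addnC gcdnMDl gcdnC.
Qed.

Lemma rough_count_mul W q r : odd W ->
  rough_count W (q * W + r) = rough_count W r + q * totient W.
Proof.
move=> W_odd; elim: q => [|q IH]; first by rewrite addn0.
by rewrite mulSn -addnA addnC rough_countD // IH mulSn; lia.
Qed.

Lemma leq_rough_count W L L' : L <= L' -> rough_count W L <= rough_count W L'.
Proof. by move=> L_L'; rewrite /rough_count [leqRHS](big_cat_nat _ (n := L)) //= leq_addr. Qed.

(** Only full periods are counted; the upper bound that follows counts the incomplete last period as
    a full one. *)
Lemma rough_count_ge W L : odd W -> (L - W) * totient W <= W * rough_count W L.
Proof.
move=> W_odd; have W_gt0 : 0 < W by case: W W_odd.
rewrite {2}(divn_eq L W) rough_count_mul //.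
have := divn_eq L W; have := ltn_pmod L W_gt0.
move: (L %/ W) (L %% W) => q r r_W ->; nia.
Qed.

Lemma rough_count_le W L : odd W -> W * rough_count W L <= (L + W) * totient W.
Proof.
move=> W_odd; have W_gt0 : 0 < W by case: W W_odd.
rewrite {1}(divn_eq L W) rough_count_mul //.
have := divn_eq L W; have r_W := ltn_pmod L W_gt0.
have := leq_rough_count W (ltnW r_W); rewrite rough_count_period //.
move: (L %/ W) (L %% W) r_W => q r r_W H ->; nia.
Qed.

(* For odd [p], the number of [b < N] such that [p] divides [2b+1]. *)
Definition multiples (N p : nat) : nat := (N.*2.-1 %/ p).+1./2.
Arguments multiples : simpl never.

Lemma multiples_lt N p c : 0 < p -> (c < multiples N p) = (p * c.*2.+1 < N.*2).
Proof.
move=> p_gt0; case: N => [|N]; first by rewrite /multiples div0n ltn0.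
have -> : (p * c.*2.+1 < N.+1.*2) = (c.*2.+1 <= N.+1.*2.-1 %/ p).
  by rewrite leq_divRL // mulnC.
rewrite /multiples; move: (_ %/ p) => x; lia.
Qed.

(** The odd multiples of [p] are the numbers [p * (2c+1)], whose index is [p * c + p./2]. *)
Lemma sum_multiples N p (F : nat -> nat) : odd p ->
  \sum_(0 <= b < N | p %| b.*2.+1) F b =
  \sum_(0 <= c < multiples N p) F (p * c + p./2).
Proof.
move=> p_odd; have p_gt0 : 0 < p by case: p p_odd.
have label c : (p * c + p./2).*2.+1 = p * c.*2.+1.
  by have := odd_double_half p; rewrite p_odd; lia.
rewrite -big_filter -(big_map (fun c => p * c + p./2) xpredT F).
apply: perm_big; apply: uniq_perm.
- by rewrite filter_uniq ?iota_uniq.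
- rewrite map_inj_uniq ?iota_uniq // => c c' /addIn /eqP.
  by rewrite eqn_pmul2l // => /eqP.
move=> b; rewrite mem_filter mem_iota leq0n /=; apply/andP/mapP.
  case=> /dvdnP[x e] b_N.
  have x_odd : odd x by have := congr1 odd e; rewrite /= odd_double oddM p_odd andbT => <-.
  have e' : b.*2.+1 = p * (x./2).*2.+1.
    by rewrite e mulnC; congr (_ * _); rewrite -{1}(odd_double_half x) x_odd.
  exists x./2; last by apply: double_inj; apply: succn_inj; rewrite label.
  rewrite mem_iota subn0 multiples_lt //= -e'; lia.
case=> c; rewrite mem_iota subn0 add0n multiples_lt //= => c_lt ->.
rewrite label dvdn_mulr //; split=> //; have := label c; lia.
Qed.

(** If there are [M > 0] multiples, the last one, [p * (2M-1)], is below [2N]; and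
    [4M(M-1) < (2M-1)^2]. *)
Lemma sqr_multiples N p : 0 < p -> p ^ 2 * (multiples N p * (multiples N p).-1) <= N ^ 2.
Proof.
move=> p_gt0; case E: (multiples N p) => [|M] /=; rewrite ?muln0 //.
have := multiples_lt N M p_gt0; rewrite E ltnSn => /esym pM.
by nia.
Qed.

Lemma multiples_pred N p : 0 < p -> p * (multiples N p).-1 <= N.
Proof.
move=> p_gt0; case E: (multiples N p) => [|M] /=; rewrite ?muln0 //.
have := multiples_lt N M p_gt0; rewrite E ltnSn => /esym pM.
by nia.
Qed.

Definition odd_primorial (D : nat) : nat :=
  \prod_(0 <= p < D.+1 | prime p && (2 < p)) p.

Lemma odd_primorialS D : odd_primorial D.+1 =
  odd_primorial D * (if prime D.+1 && (2 < D.+1) then D.+1 else 1).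
Proof. by rewrite /odd_primorial !(big_mkcond (fun p => prime p && _)) big_nat_recr. Qed.

Lemma odd_odd_primorial D : odd (odd_primorial D).
Proof.
apply: (big_ind odd) => [//|x y|p /andP[p_pr p_gt2]]; first by rewrite oddM => -> ->.
by case: (even_prime p_pr) p_gt2 => // ->.
Qed.

Lemma dvdn_odd_primorial D p : prime p -> 2 < p <= D -> p %| odd_primorial D.
Proof.
move=> p_pr /andP[p_gt2 p_D]; rewrite /odd_primorial big_mkord.
have p_D' : p < D.+1 by [].
by rewrite (bigD1 (Ordinal p_D')) /= ?p_pr // dvdn_mulr.
Qed.

Lemma coprime_odd_primorial D p : prime p -> D < p -> coprime p (odd_primorial D).
Proof.
move=> p_pr D_p; rewrite /odd_primorial big_nat_cond.
apply: (big_ind (coprime p)) => [|x y px py|q].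
- exact: coprimen1.
- by rewrite coprimeMr px.
- move=> /andP[q_D /andP[q_pr _]].
  by rewrite prime_coprime // dvdn_prime2 //; apply/eqP => e; lia.
Qed.

(** Equality holds at [D = 8]. If [D + 1] is prime, the new factor [1 - 1/(D+1)] of the density
    exactly offsets the growth from [D] to [D + 1]; otherwise the right side only grows. *)
Lemma totient_odd_primorial D : 8 <= D ->
  384 * odd_primorial D <= 105 * (D * totient (odd_primorial D)).
Proof.
elim: D => // D IH; rewrite leq_eqVlt => /predU1P[<-|]; last first.
  move=> /[dup] D_ge8 /IH {}IH; rewrite odd_primorialS.
  case: ifP => [/andP[p_pr _]|_]; last first.
    rewrite muln1; move: (odd_primorial D) (totient _) IH => w f; lia.
  rewrite totient_coprime; last by rewrite coprime_sym coprime_odd_primorial.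
  rewrite (totient_prime p_pr) /=; have := leq_mul (leqnn D.+1) IH.
  move: (odd_primorial D) (totient _) => w f; lia.
have W8 : odd_primorial 8 = 3 * 5 * 7.
  by rewrite /odd_primorial unlock.
by rewrite W8 !totient_coprime // !totient_prime.
Qed.

Lemma size_primes_leq m : 0 < m -> 2 ^ size (primes m) <= m.
Proof.
move=> m_gt0; rewrite [leqRHS](prod_prime_decomp m_gt0) size_map.
rewrite -[X in 2 ^ X]count_predT -iter_muln_1 -big_const_seq big_seq [leqRHS]big_seq.
apply: leq_prod => -[p e] /mem_prime_decomp[p_pr e_gt0 _] /=.
by rewrite (leq_trans (prime_gt1 p_pr)) // -{1}[p]expn1 leq_pexp2l // prime_gt0.
Qed.

(** Double counting: a label below [2 ^ lam] has at most [lam] prime factors. *)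
Lemma sum_multiples_pred N c0 lam : N.*2 <= 2 ^ lam ->
  \sum_(c0 <= c < N | prime c.*2.+1) (multiples N c.*2.+1).-1 <= N * lam.
Proof.
move=> N_lam.
have mult c : multiples N c.*2.+1 = \sum_(0 <= b < N) (c.*2.+1 %| b.*2.+1).
  rewrite -big_mkcond /= sum_multiples /= ?odd_double //.
  by rewrite sum_nat_const_nat subn0 muln1.
apply: (@leq_trans (\sum_(c0 <= c < N | prime c.*2.+1)
                      \sum_(0 <= b < N) (c.*2.+1 %| b.*2.+1))).
  by apply: leq_sum => c _; rewrite -mult leq_pred.
rewrite exchange_big /= -{3}[N]subn0 -sum_nat_const_nat big_nat [leqRHS]big_nat.
apply: leq_sum => b /andP[_ b_N].
have b_lt : b.*2.+1 <= 2 ^ lam by apply: leq_trans N_lam; lia.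
have /leq_trans /(_ b_lt) := size_primes_leq (ltn0Sn b.*2).
rewrite leq_exp2l //; apply: leq_trans.
rewrite -big_mkcondr /= -big_filter sum1_size -(size_map (fun c => c.*2.+1)).
apply: uniq_leq_size.
  rewrite map_inj_uniq ?filter_uniq ?iota_uniq // => x y [/double_inj].
  by [].
move=> p /mapP[c]; rewrite mem_filter => /andP[/andP[c_pr c_b] _] ->.
by rewrite mem_primes c_pr c_b.
Qed.


(* A common factor of two distinct odd numbers, the first of which has no prime
   factor up to [D], is witnessed by a prime [2c+1 > D]; the union bound counts
   the multiples of each such prime. *)
Lemma conf_le N a D : coprime a.*2.+1 (odd_primorial D) -> a < N ->
  conf N a <= \sum_(uphalf D <= c < N | prime c.*2.+1)
     (c.*2.+1 %| a.*2.+1) * (multiples N c.*2.+1).-1.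
Proof.
move=> a_cop a_N.
apply: (@leq_trans (\sum_(0 <= b < N) \sum_(uphalf D <= c < N | prime c.*2.+1)
   (c.*2.+1 %| a.*2.+1) * ((c.*2.+1 %| b.*2.+1) && (b != a)))).
  rewrite /conf -[N in iota 0 N]subn0 -sum1_count big_mkcond /=; apply: leq_sum => b _.
  case: ifP => // /andP[b_a]; rewrite /cop /coprime => ab_gcd.
  set g := gcdn _ _ in ab_gcd.
  have g_gt1 : 1 < g by rewrite ltn_neqAle eq_sym ab_gcd gcdn_gt0.
  have p_pr := pdiv_prime g_gt1; set p := pdiv g in p_pr.
  have p_a : p %| a.*2.+1 := dvdn_trans (pdiv_dvd g) (dvdn_gcdl _ _).
  have p_b : p %| b.*2.+1 := dvdn_trans (pdiv_dvd g) (dvdn_gcdr _ _).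
  have p_odd : odd p by apply: dvdn_odd p_a _; rewrite /= odd_double.
  have p_gt2 : 2 < p by case: (p) p_pr p_odd => [|[|[]]].
  have p_D : D < p.
    rewrite ltnNge; apply/negP => p_D.
    have p_W : p %| odd_primorial D by rewrite dvdn_odd_primorial ?p_gt2.
    have := coprime_dvdr p_W a_cop; rewrite coprime_sym prime_coprime //.
    by rewrite p_a.
  have pE : p = p./2.*2.+1 by rewrite -{1}(odd_double_half p) p_odd.
  have p_le := dvdn_leq (ltn0Sn _) p_a.
  have c_in : uphalf D <= p./2 < N by lia.
  rewrite big_mkcond (bigD1_seq p./2) ?mem_index_iota ?iota_uniq //=.
  by rewrite -pE p_pr p_a p_b b_a.
rewrite exchange_big /=; apply: leq_sum => c c_pr; rewrite -big_distrr /=.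
case: (boolP (_ %| _)) => [c_a|_] //; rewrite !mul1n.
have : \sum_(0 <= b < N) (c.*2.+1 %| b.*2.+1) = multiples N c.*2.+1.
  rewrite -big_mkcond /= sum_multiples /= ?odd_double //.
  by rewrite sum_nat_const_nat subn0 muln1.
(* The label [a] is itself a multiple; leaving it out gives the predecessor. *)
rewrite !(bigD1_seq a) ?mem_index_iota ?iota_uniq //= c_a eqxx andbF /= => <- /=.
by apply: leq_sum => b ->; rewrite andbT.
Qed.

(** After exchanging the sums in [conf_le], fix a prime [p = 2c+1]: a multiple [p * (2b+1)] coprime
    to [W] has its cofactor [2b+1] coprime to [W]. *)
Lemma sum_conf_le N D (W := odd_primorial D) :
  \sum_(0 <= a < N | coprime a.*2.+1 W) conf N a <=
  \sum_(uphalf D <= c < N | prime c.*2.+1)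
     rough_count W (multiples N c.*2.+1) * (multiples N c.*2.+1).-1.
Proof.
apply: (@leq_trans (\sum_(0 <= a < N | coprime a.*2.+1 W)
  \sum_(uphalf D <= c < N | prime c.*2.+1)
     (c.*2.+1 %| a.*2.+1) * (multiples N c.*2.+1).-1)).
  rewrite big_nat_cond [leqRHS]big_nat_cond.
  by apply: leq_sum => a /andP[/andP[_ a_N] a_W]; apply: conf_le.
rewrite exchange_big /= big_nat_cond [leqRHS]big_nat_cond.
apply: leq_sum => c /andP[/andP[c_D c_N] c_pr].
rewrite -big_distrl leq_mul2r /=; apply/orP; right.
rewrite big_mkcond /= (eq_bigr (fun a => if c.*2.+1 %| a.*2.+1 then coprime a.*2.+1 W : nat else 0)); last first.
  by move=> a _; case: (coprime _ _); case: (_ %| _).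
rewrite -big_mkcond sum_multiples /= ?odd_double // /rough_count.
apply: leq_sum => b _; rewrite uphalf_double.
have -> : (c.*2.+1 * b + c).*2.+1 = c.*2.+1 * b.*2.+1 by lia.
by rewrite coprimeMl; case: (coprime b.*2.+1 W); rewrite ?andbF // leq_b1.
Qed.

(** By [sqr_multiples] each term is at most [N^2 / (2c+1)^2], which is at most
    [N^2/4 * (1/c - 1/(c+1))]; this telescopes. *)
Lemma sum_sqr_multiples N c0 :
  4 * c0 * \sum_(c0 <= c < N | prime c.*2.+1)
     (multiples N c.*2.+1 * (multiples N c.*2.+1).-1) <= N ^ 2.
Proof.
have [c0_N|N_c0] := leqP c0 N; last by rewrite big_geq ?muln0 // ltnW.
have [k] := ubnP (N - c0); elim: k c0 c0_N => // k IH c0 c0_N N_k.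
move: c0_N; rewrite leq_eqVlt => /predU1P[->|c0_N]; first by rewrite big_geq ?muln0.
rewrite big_ltn_cond //; have : N - c0.+1 < k by lia.
move=> /(IH c0.+1 c0_N) {IH}.
have x_le : 4 * c0 * c0.+1 * (multiples N c0.*2.+1 * (multiples N c0.*2.+1).-1) <= N ^ 2.
  apply: leq_trans (sqr_multiples N (ltn0Sn c0.*2)); rewrite leq_mul2r; apply/orP; right.
  by nia.
set S := \sum_(_ <= _ < _ | _) _ => S_le /=.
rewrite -(leq_pmul2l (ltn0Sn c0)); case: ifP => _; last by nia.
move: (multiples _ _ * _) x_le => x x_le; nia.
Qed.

Lemma many_low_conf N D lam (W := odd_primorial D) : 8 <= D -> 0 < N ->
  N.*2 <= 2 ^ lam -> 48 * W * (1 + D * lam) <= N ->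
  7 * N <= 4 * D * count (fun a => D * conf N a <= N) (iota 0 N).
Proof.
move=> D_ge8 N_gt0 N_lam W_N.
set F := count _ _; pose f := totient W.
have W_odd : odd W := odd_odd_primorial D.
pose X := \sum_(uphalf D <= c < N | prime c.*2.+1)
            (multiples N c.*2.+1 * (multiples N c.*2.+1).-1).
pose Y := \sum_(uphalf D <= c < N | prime c.*2.+1) (multiples N c.*2.+1).-1.
pose S := \sum_(0 <= a < N | coprime a.*2.+1 W) conf N a.
pose bad := \sum_(0 <= a < N | coprime a.*2.+1 W) (N < D * conf N a).
have X_le : 2 * D * X <= N ^ 2.
  apply: leq_trans (sum_sqr_multiples N (uphalf D)).
  by rewrite leq_mul2r; apply/orP; right; lia.
have Y_le : Y <= N * lam := sum_multiples_pred _ N_lam.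
(* [X] is the main term; [W * Y] pays for the incomplete periods mod [W]. *)
have S_le : W * S <= f * (X + W * Y).
  apply: (leq_trans (leq_mul (leqnn W) (sum_conf_le N D))).
  rewrite big_distrr mulnDr mulnA /X /Y !big_distrr -big_split /=.
  apply: leq_sum => c _; set M := multiples N c.*2.+1.
  by have := leq_mul (leqnn M.-1) (rough_count_le M W_odd); rewrite -/f -/W; lia.
have bad_le : bad * N <= D * S.
  rewrite /bad /S big_distrl big_distrr /=; apply: leq_sum => a _.
  by case: ltnP => [/ltnW|_]; rewrite ?mul1n ?mul0n.
have rough_le : rough_count W N <= F + bad.
  rewrite /F -[N in iota 0 N]subn0 -sum1_count [X in X + _]big_mkcond.
  rewrite /rough_count /bad [X in _ + X]big_mkcond -big_split.
  by apply: leq_sum => a _ /=; case: leqP; case: (coprime _ _).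
have rough_ge := rough_count_ge N W_odd.
have f_ge : 384 * W <= 105 * (D * f) := totient_odd_primorial D_ge8.
have W_gt0 : 0 < W by case: (W) W_odd.
rewrite -/f in rough_ge; clearbody F f X Y S bad.
move: (rough_count W N) rough_le rough_ge => rc rc_le rc_ge.
clear W_odd N_lam; clearbody W.
(* Markov's inequality [bad_le], with [X <= N^2 / 2D] and [Y <= N * lam]. *)
have bad2 : 2 * W * bad <= f * (N + 2 * D * W * lam).
  rewrite -(leq_pmul2r N_gt0).
  have := leq_mul (leqnn (2 * W)) bad_le.
  have := leq_mul (leqnn (2 * D)) S_le.
  have := leq_mul (leqnn f) X_le.
  have := leq_mul (leqnn (f * 2 * D * W)) Y_le.
  rewrite -mulnn; lia.
(* Half of the density [f / W] survives, less the errors, which [W_N] bounds by [1/48] of it: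
   [1/2 - 1/48 = 23/48]. *)
have F_ge : f * (23 * N) <= 48 * W * F.
  have := leq_mul (leqnn f) W_N; have := leq_mul (leqnn (48 * W)) rc_le.
  rewrite mulnBl in rc_ge; lia.
(* [23/48 * 384/105 = 184/105], which exceeds [7/4]. *)
rewrite -(leq_pmul2l W_gt0).
have := leq_mul f_ge (leqnn (23 * N)); have := leq_mul (leqnn (105 * D)) F_ge; lia.
Qed.

(** * Counting primes *)

Lemma prod_primes_dvdn m n X :
  (forall p, prime p -> m <= p < n -> p %| X) ->
  \prod_(m <= p < n | prime p) p %| X.
Proof.
elim: n => [|n IH] p_X; first by rewrite big_geq ?dvd1n.
have [n_lt|m_le] := ltnP n m; first by rewrite big_geq ?dvd1n.
rewrite big_mkcond big_nat_recr //= -big_mkcond /=.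
have {}IH : \prod_(m <= p < n | prime p) p %| X.
  by apply: IH => p p_pr /andP[m_p p_n]; apply: p_X => //; rewrite m_p leqW.
case: ifP => [n_pr|_]; last by rewrite muln1.
rewrite Gauss_dvd ?IH ?p_X ?m_le ?leqnn // coprime_sym big_nat_cond.
apply: (big_ind (coprime n)) => [|x y nx ny|q /andP[/andP[_ q_n] q_pr]].
- exact: coprimen1.
- by rewrite coprimeMr nx.
- by rewrite prime_coprime // dvdn_prime2 // gtn_eqF.
Qed.

Lemma sum_bin n : \sum_(i < n.+1) 'C(n, i) = 2 ^ n.
Proof.
by rewrite -[2]/(1 + 1) expnDn; apply: eq_bigr => i _; rewrite !exp1n !muln1.
Qed.

(** Row [2m+1] of Pascal's triangle has two equal middle entries and sum [2 * 4^m]. *)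
Lemma bin_mid_leq m : 'C(m.*2.+1, m) <= 4 ^ m.
Proof.
have m_lt : m < m.*2.+2 by lia.
have m1_lt : m.+1 < m.*2.+2 by lia.
have : 'C(m.*2.+1, m) + 'C(m.*2.+1, m.+1) <= 2 ^ m.*2.+1.
  rewrite -sum_bin (bigD1 (Ordinal m_lt)) //= leq_add2l.
  rewrite (bigD1 (Ordinal m1_lt)) /= ?leq_addr //.
  by apply/eqP => /(congr1 val) /= /eqP; rewrite (gtn_eqF (ltnSn m)).
have -> : 'C(m.*2.+1, m.+1) = 'C(m.*2.+1, m).
  by rewrite -(@bin_sub _ m); [congr 'C(_, _); lia | lia].
have -> : 2 ^ m.*2.+1 = 2 * 4 ^ m by rewrite expnS -mul2n expnM.
lia.
Qed.

Lemma prime_dvdn_fact p n : prime p -> p %| n`! -> p <= n.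
Proof.
move=> p_pr; elim: n => [|n IH]; first by rewrite dvdn1 => /eqP p1; rewrite p1 in p_pr.
by rewrite factS Euclid_dvdM // => /orP[/dvdn_leq -> //|/IH /leqW].
Qed.

(** Erdős's argument: for [n = 2m+1], the primes from [m+2] to [n] all divide ['C(2m+1, m)], and
    induction handles those up to [m+1]. *)
Lemma primorial_leq n : \prod_(0 <= p < n.+1 | prime p) p <= 4 ^ n.
Proof.
have [k] := ubnP n; elim: k n => // k IH n n_k.
have [n_le2|n_gt2] := leqP n 2.
  by case: n n_le2 {n_k} => [|[|[]]] // _; rewrite unlock.
have [n_odd|n_even] := boolP (odd n); last first.
  rewrite big_mkcond big_nat_recr //= -big_mkcond /=.
  have -> : prime n = false.
    by apply/negP => /even_prime[e|]; [rewrite e in n_gt2 | apply/negP].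
  rewrite muln1; case: n n_k n_gt2 {n_even} => // n n_k _.
  by apply: (leq_trans (IH n _)); rewrite ?leq_pexp2l.
have nE : n = n./2.*2.+1 by rewrite -{1}(odd_double_half n) n_odd.
move: n_k n_gt2; rewrite nE; move: n./2 => m n_k n_gt2.
rewrite (big_cat_nat _ (n := m.+2)) //=; last by lia.
have -> : 4 ^ m.*2.+1 = 4 ^ m.+1 * 4 ^ m by rewrite -expnD; congr (4 ^ _); lia.
apply: leq_mul; first by apply: IH; lia.
apply: leq_trans (bin_mid_leq m); apply: dvdn_leq; first by rewrite bin_gt0; lia.
apply: prod_primes_dvdn => p p_pr /andP[m_p p_m].
have : p %| (m.*2.+1)`! by apply: dvdn_fact; rewrite prime_gt0.
rewrite -(@bin_fact m.*2.+1 m); last by lia.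
rewrite !Euclid_dvdM // => /orP[//|/orP[] /(prime_dvdn_fact p_pr)]; lia.
Qed.

Lemma bin_double_rec N : N.+1 * 'C(N.+1.*2, N.+1) = 2 * N.*2.+1 * 'C(N.*2, N).
Proof.
have := mul_bin_diag N.*2.+2 N; have := mul_bin_diag N.*2.+1 N => /=.
have -> : 'C(N.*2.+1, N.+1) = 'C(N.*2.+1, N).
  by rewrite -(@bin_sub _ N); [congr 'C(_, _); lia | lia].
rewrite doubleS; lia.
Qed.

Lemma central_bin_geq N : 0 < N -> 4 ^ N <= N.*2 * 'C(N.*2, N).
Proof.
elim: N => // -[_ _|N IH _]; first by [].
have {IH} := IH isT; have := bin_double_rec N.+1.
rewrite [4 ^ N.+2]expnS; move: 'C(N.+2.*2, _) 'C(N.+1.*2, _) (4 ^ _) => x y z.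
lia.
Qed.

(** In Legendre's formula, each power [p^k] contributes at most 1 to the exponent, and nothing once
    [p^k > 2N]. *)
Lemma logn_central_bin p N : prime p -> 0 < N -> p ^ logn p 'C(N.*2, N) <= N.*2.
Proof.
move=> p_pr N_gt0; have p_gt1 := prime_gt1 p_pr.
pose T := trunc_log p N.*2; apply: (@leq_trans (p ^ T)); last first.
  by apply: trunc_logP => //; lia.
rewrite leq_pexp2l ?prime_gt0 //.
have NN : N <= N.*2 by lia.
have := congr1 (logn p) (bin_fact NN).
have -> : N.*2 - N = N by lia.
rewrite !lognM ?muln_gt0 ?fact_gt0 ?bin_gt0 // !logn_fact //.
have -> : \sum_(1 <= k < N.+1) N %/ p ^ k = \sum_(1 <= k < N.*2.+1) N %/ p ^ k.
  rewrite [RHS](big_cat_nat _ (n := N.+1)) //=.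
  rewrite [X in _ = _ + X]big_nat_cond [X in _ = _ + X]big1 ?addn0 // => k /andP[/andP[N_k _] _].
  by rewrite divn_small // (ltn_trans N_k) // ltn_expl.
have : \sum_(1 <= k < N.*2.+1) N.*2 %/ p ^ k <=
       \sum_(1 <= k < N.*2.+1) (2 * (N %/ p ^ k) + (k <= T)).
  apply: leq_sum => k _; have pk_gt0 : 0 < p ^ k by rewrite expn_gt0 prime_gt0.
  case: (leqP k T) => [_|T_k]; last first.
    rewrite divn_small // (leq_trans (trunc_log_ltn _ p_gt1)) //.
    by rewrite leq_pexp2l // prime_gt0.
  rewrite -ltnS ltn_divLR //; have := divn_eq N (p ^ k); have := ltn_pmod N pk_gt0.
  move: (p ^ k) pk_gt0 => w w_gt0; move: (N %/ w) (N %% w) => u v. nia.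
rewrite big_split /= -big_distrr /= => H.
have : \sum_(1 <= k < N.*2.+1) (k <= T) <= T.
  rewrite -big_mkcond /= -big_filter sum1_size -[leqRHS](size_iota 1).
  apply: uniq_leq_size; first by rewrite filter_uniq ?iota_uniq.
  by move=> k; rewrite mem_filter !mem_iota; lia.
lia.
Qed.

(* Primes enter as labels [2c+1] with [c < N], so 2 is left out. *)
Definition big_primes (N : nat) : seq nat :=
  [seq c <- iota 0 N | prime c.*2.+1 && (N <= 11 * c.*2.+1)].

(* In the prime factorisation of the central binomial coefficient, primes up to
   [sqrt (2N)] and primes above [N / 11] contribute at most [2N] each, and the
   others at most the primorial of [N / 11]. *)
Lemma size_big_primes N lam r : 1 < N -> N.*2 <= 2 ^ lam -> N.*2 < r.+1 ^ 2 ->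
  20 * N <= 11 * (lam * (1 + r + size (big_primes N))).
Proof.
move=> N_gt1 N_lam N_r; have N_gt0 := ltnW N_gt1; set q := size _.
pose X := 'C(N.*2, N); pose P := primes X.
have X_gt0 : 0 < X by rewrite bin_gt0; lia.
have P_prime p : p \in P -> prime p by rewrite mem_primes => /andP[].
have P_lt p : p \in P -> p <= N.*2.
  rewrite mem_primes => /and3P[p_pr _ p_X]; apply: prime_dvdn_fact => //.
  have NN : N <= N.*2 by lia.
  by rewrite -(bin_fact NN) dvdn_mulr.
have P_pow p : p \in P -> p ^ logn p X <= N.*2.
  by move/P_prime => p_pr; apply: logn_central_bin.
pose small p := p * p <= N.*2; pose mid p := 11 * p < N.
have X_prod : X = \prod_(p <- P) p ^ logn p X.
  by rewrite {1}(prod_prime_decomp X_gt0) prime_decompE big_map.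
have small_le : \prod_(p <- P | small p) p ^ logn p X <= N.*2 ^ r.
  rewrite -big_filter; set A := filter _ _.
  have A_size : size A <= r.
    rewrite -[leqRHS](size_iota 1); apply: uniq_leq_size; first by rewrite filter_uniq ?primes_uniq.
    move=> p; rewrite mem_filter mem_iota /small => /andP[p_s /P_prime/prime_gt0 p_gt0].
    by nia.
  apply: (@leq_trans (N.*2 ^ size A)); last by rewrite leq_pexp2l //; lia.
  rewrite -[X in _ ^ X]count_predT -iter_muln_1 -big_const_seq big_seq [leqRHS]big_seq.
  by apply: leq_prod => p; rewrite mem_filter => /andP[_ /P_pow].
have big_le : \prod_(p <- P | ~~ small p && ~~ mid p) p ^ logn p X <= N.*2 ^ q.
  rewrite -big_filter; set A := filter _ _.
  have A_size : size A <= q.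
    rewrite /q -[leqRHS](size_map (fun c => c.*2.+1)); apply: uniq_leq_size.
      by rewrite filter_uniq ?primes_uniq.
    move=> p; rewrite mem_filter /small /mid -!ltnNge => /andP[/andP[p_s p_m] p_P].
    have p_odd : odd p.
      case: (even_prime (P_prime p p_P)) => // p2; rewrite p2 in p_s; lia.
    have pE : p = p./2.*2.+1 by rewrite -{1}(odd_double_half p) p_odd.
    apply/mapP; exists p./2 => //; rewrite mem_filter -pE P_prime // mem_iota.
    by have := P_lt p p_P; lia.
  apply: (@leq_trans (N.*2 ^ size A)); last by rewrite leq_pexp2l //; lia.
  rewrite -[X in _ ^ X]count_predT -iter_muln_1 -big_const_seq big_seq [leqRHS]big_seq.
  by apply: leq_prod => p; rewrite mem_filter => /andP[_ /P_pow].
(* Here [p^2 > 2N], so by [P_pow] the exponent is at most 1. *)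
have mid_le : \prod_(p <- P | ~~ small p && mid p) p ^ logn p X <= 4 ^ (N %/ 11).
  apply: leq_trans (primorial_leq _).
  apply: (@leq_trans (\prod_(p <- P | ~~ small p && mid p) p)).
    rewrite big_seq_cond [leqRHS]big_seq_cond; apply: leq_prod => p /andP[p_P /andP[p_s _]].
    rewrite -[leqRHS]expn1 leq_pexp2l ?prime_gt0 ?P_prime //.
    rewrite leqNgt; apply: contra p_s => l_gt1; apply: leq_trans (P_pow p p_P).
    by rewrite mulnn leq_pexp2l ?prime_gt0 ?P_prime.
  rewrite -big_filter; set A := filter _ _.
  have A_mid p : p \in A -> prime p && (p < (N %/ 11).+1).
    rewrite mem_filter /mid => /andP[/andP[_ p_m] /P_prime ->] /=.
    by rewrite ltnS leq_divRL // mulnC ltnW.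
  rewrite [leqRHS](bigID (mem A)) -[X in _ <= X * _]big_filter.
  rewrite [X in _ <= X * _](perm_big A).
    by rewrite leq_pmulr // prodn_cond_gt0 // => p /andP[/prime_gt0].
  apply: uniq_perm; rewrite ?filter_uniq ?iota_uniq ?primes_uniq // => p.
  rewrite mem_filter mem_index_iota /=; case: (boolP (p \in A)) => [/A_mid/andP[-> ->]|] //.
  by rewrite andbF.
have X_le : X <= N.*2 ^ r * (4 ^ (N %/ 11) * N.*2 ^ q).
  rewrite {1}X_prod (bigID small) /= leq_mul // (bigID mid) /=.
  exact: leq_mul.
have := leq_trans (central_bin_geq N_gt0) (leq_mul (leqnn N.*2) X_le).
have -> : N.*2 * (N.*2 ^ r * (4 ^ (N %/ 11) * N.*2 ^ q)) = N.*2 ^ (1 + r + q) * 4 ^ (N %/ 11).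
  by rewrite !expnD expn1; lia.
(* Compare exponents of 2; [2N - 2N/11 = 20N/11]. *)
move=> H; have {H} : 2 ^ N.*2 <= 2 ^ (lam * (1 + r + q) + 2 * (N %/ 11)).
  rewrite expnD !(expnM 2) -[N.*2]mul2n (expnM 2).
  by apply: (leq_trans H); rewrite leq_mul // leq_exp2r.
rewrite leq_exp2l //; have := leq_trunc_div N 11; lia.
Qed.

Lemma sqrt_exists m : exists r, r ^ 2 <= m < r.+1 ^ 2.
Proof.
elim: m => [|m [r /andP[r_le r_gt]]]; first by exists 0.
have [m_lt|m_ge] := ltnP m.+1 (r.+1 ^ 2); first by exists r; rewrite m_lt leqW.
exists r.+1; rewrite m_ge; apply: (leq_ltn_trans r_gt).
by rewrite ltn_exp2r.
Qed.

(** This gives the size hypothesis of [many_low_conf] for [D = 8], given [2 ^ lam <= 4N]. *)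
Lemma linear_leq_exp lam : 22 <= lam -> 4 * (48 * 105 * (1 + 8 * lam)) <= 2 ^ lam.
Proof.
elim: lam => // lam IH; rewrite leq_eqVlt => /predU1P[<-|]; first by lia.
by move=> lam_ge; have := IH lam_ge; rewrite expnS; move: (2 ^ lam) => x; lia.
Qed.

Lemma quadratic_leq_exp lam : 22 <= lam -> 36 * lam ^ 2 <= 2 ^ lam.-1.
Proof.
move=> lam_ge; have : 72 * lam ^ 2 <= 2 ^ lam.
  elim: lam lam_ge => // lam IH; rewrite leq_eqVlt => /predU1P[<-|]; first by lia.
  by move=> lam_ge; have := IH lam_ge; rewrite [2 ^ lam.+1]expnS -!mulnn; move: (2 ^ lam) => x; nia.
by case: lam lam_ge => // lam _; rewrite [2 ^ lam.+1]expnS /=; lia.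
Qed.

Lemma double_leq_exp k : 0 < k -> k.*2 <= 2 ^ k.
Proof. by case: k => // k _; have := ltn_expl k (ltnSn 1); rewrite expnS; lia. Qed.

(** The same for [D = e + 1], with the odd primorial bounded by [4 ^ D]. *)
Lemma exp_leq_exp e lam : 8 <= e -> 11 * e <= lam ->
  4 * (48 * 4 ^ e.+1 * (1 + e.+1 * lam)) <= 2 ^ lam.
Proof.
move=> e_ge8 e_lam; pose k := lam - 3 * e - 11.
have -> : 2 ^ lam = 2 ^ 11 * (2 ^ e * 2 ^ e * 2 ^ e) * 2 ^ k.
  by rewrite -!expnD; congr (2 ^ _); rewrite /k; lia.
have lam_k : lam <= 2 ^ k.
  by apply: (@leq_trans k.*2); [rewrite /k; lia | apply: double_leq_exp; rewrite /k; lia].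
have e_lt : e.+1 <= 2 ^ e by exact: ltn_expl.
have -> : 4 ^ e.+1 = 4 * (2 ^ e * 2 ^ e) by rewrite -expnD addnn expnS -mul2n expnM.
have : e.+1 * lam <= 2 ^ e * 2 ^ k by exact: leq_mul.
have : 0 < 2 ^ e * 2 ^ k by rewrite muln_gt0 !expn_gt0.
move: (2 ^ e) (2 ^ k) (e.+1 * lam) => u v w uv_gt0 w_le.
have -> : 2 ^ 11 = 2048 by [].
have : u * u * (1 + w) <= u * u * (2 * (u * v)) by rewrite leq_mul2l; apply/orP; right; lia.
lia.
Qed.

Lemma big_primes_small N : N <= 128 -> N < 12 * size (big_primes N) + 26.
Proof.
move=> N_le; have : all (fun N => N < 12 * size (big_primes N) + 26) (iota 0 129).
  by vm_compute.
by move/allP/(_ N); rewrite mem_iota; apply.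
Qed.

(** If [t >= 11] and the spine needs more labels than 1 and the [q] big primes, then
    [N >= 12 * (q + 2) + 2 = 12 * q + 26]. So this says that for [lam <= 21] the primes never run
    out. *)
Lemma size_big_primes_medium N lam : 1 < N -> 2 ^ lam.-1 < N.*2 <= 2 ^ lam ->
  lam <= 21 -> N < 12 * size (big_primes N) + 26.
Proof.
move=> N_gt1 /andP[lam_N N_lam] lam_le.
have [N_small|N_large] := leqP N 128; first exact: big_primes_small.
have lam_ge : 9 <= lam.
  by rewrite -(ltn_exp2l (m := 2)) //; apply: leq_trans N_lam; lia.
have [r /andP[r_le r_gt]] := sqrt_exists N.*2.
have := size_big_primes N_gt1 N_lam r_gt; move: (size _) => q H.
rewrite ltnNge; apply/negP => q_le; clear r_gt N_lam.
(* The 13 values of [lam] from 9 to 21; for them [11 * lam / 12 < 20], so [q <= (N - 26) / 12]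
   contradicts [H]. *)
do 13 (move: lam_ge; rewrite leq_eqVlt => /predU1P[e|lam_ge]; [subst lam; simpl in lam_N; nia|]).
by lia.
Qed.

(** As [6 * lam <= r + 1], the term [lam * (1 + r)] is only about [N / 3]. *)
Lemma size_big_primes_large N lam : 2 ^ lam.-1 < N.*2 <= 2 ^ lam ->
  22 <= lam -> N <= lam * size (big_primes N).
Proof.
move=> /andP[lam_N N_lam] lam_ge; have := quadratic_leq_exp lam_ge => lam2.
have [r /andP[r_le r_gt]] := sqrt_exists N.*2.
have N_gt1 : 1 < N by nia.
have := size_big_primes N_gt1 N_lam r_gt; move: (size _) => q H.
have r_lam : 6 * lam <= r.+1.
  by rewrite -(@leq_exp2r _ _ 2) // expnMn; lia.
nia.
Qed.

(** * Choosing the spine *)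

Lemma conf0 N : conf N 0 = 0.
Proof.
by apply/eqP; rewrite -leqn0 leqNgt -has_count; apply/hasPn => b _; rewrite /cop coprime1n andbF.
Qed.

(** This is [conf_le] with [D = 0], where only the term of the prime itself is nonzero. *)
Lemma conf_prime N c : prime c.*2.+1 -> c < N ->
  conf N c <= (multiples N c.*2.+1).-1.
Proof.
move=> c_pr c_N; have c_cop : coprime c.*2.+1 (odd_primorial 0).
  by rewrite /odd_primorial unlock coprimen1.
apply: (leq_trans (conf_le c_cop c_N)).
rewrite big_mkcond (bigD1_seq c) ?mem_index_iota ?iota_uniq //= c_pr dvdnn mul1n.
rewrite big1 ?addn0 // => c' c'_c; case: ifP => // c'_pr.
by rewrite dvdn_prime2 // eqSS (inj_eq double_inj) (negbTE c'_c).
Qed.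

Lemma conf_big_primes N c : c \in big_primes N -> conf N c <= 11.
Proof.
rewrite mem_filter mem_iota => /andP[/andP[c_pr c_N] /andP[_ c_lt]].
apply: (leq_trans (conf_prime c_pr c_lt)).
have := multiples_pred N (ltn0Sn c.*2); move: (_.-1) => m; nia.
Qed.

(** Pigeonhole: an unsuitable label lies in [s] or conflicts with [z]. The label [z], which [conf]
    leaves out, is covered by [s]. *)
Lemma exists_label N (P : pred nat) (s : seq nat) z : z \in s ->
  size s + conf N z < count P (iota 0 N) ->
  exists a, [/\ a < N, P a, a \notin s & cop z a].
Proof.
move=> z_s; rewrite ltnNge => P_many.
have : has (fun a => [&& P a, a \notin s & cop z a]) (iota 0 N).
  apply: contraR P_many => /hasPn none.
  rewrite /conf -!size_filter -size_cat; apply: uniq_leq_size.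
    by rewrite filter_uniq ?iota_uniq.
  move=> a; rewrite mem_cat !mem_filter => /andP[Pa a_N].
  have := none a a_N; rewrite Pa a_N andbT /=.
  by case: eqP => [->|_]; [rewrite z_s | case: (a \in s)].
case/hasP => a; rewrite mem_iota => /andP[_ a_N] /and3P[Pa a_s za].
by exists a.
Qed.

(** The hypotheses of [odd_prime_of_spine], as an invariant for a spine under construction. *)
Definition spine_prefix (N t : nat) (s : seq nat) : Prop :=
  [/\ uniq s, {in s, forall a, a < N}, nth 0 s 0 = 0,
      forall i, i.+1 < size s -> cop (nth 0 s i) (nth 0 s i.+1) &
      forall i, i < size s -> conf N (nth 0 s i) <= t * i].

Lemma spine_prefix_primes N t m : 11 <= t -> 0 < N ->
  spine_prefix N t (take m (0 :: big_primes N)).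
Proof.
move=> t_ge11 N_gt0; set s := 0 :: _.
have big_primesP c : c \in big_primes N -> prime c.*2.+1 /\ c < N.
  by rewrite mem_filter mem_iota => /andP[/andP[-> _] /andP[_ ->]].
have s_u : uniq s.
  rewrite /= filter_uniq ?iota_uniq // andbT.
  by apply/negP => /big_primesP[].
split.
- exact: take_uniq.
- by move=> a /mem_take; rewrite inE => /predU1P[->|/big_primesP[]].
- by case: m.
- move=> i i_lt;
  have /andP[i_m i_s] : (i.+1 < m) && (i.+1 < size s).
    by move: i_lt; rewrite size_take_min leq_min.
  rewrite !nth_take //; last exact: ltnW.
  have /big_primesP[p_pr _] : nth 0 s i.+1 \in big_primes N
    by exact: (@mem_nth _ 0 (big_primes N) i i_s).
  rewrite /cop coprime_sym prime_coprime //.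
  case: i i_s {i_lt i_m} p_pr => [|i] i_s p_pr.
    by rewrite [nth 0 s 0]/= dvdn1; apply: contraTneq p_pr => ->.
  have /big_primesP[p'_pr _] : nth 0 s i.+1 \in big_primes N
    by exact: (@mem_nth _ 0 (big_primes N) i (ltnW i_s)).
  rewrite dvdn_prime2 // eqSS (inj_eq double_inj) nth_uniq //; last exact: ltnW.
  by rewrite gtn_eqF.
- move=> i i_lt;
  have /andP[i_m i_s] : (i < m) && (i < size s).
    by move: i_lt; rewrite size_take_min leq_min.
  rewrite nth_take //; case: i i_s {i_lt i_m} => [|i] i_s; first by rewrite conf0.
  apply: (@leq_trans 11); first by apply: conf_big_primes; exact: (@mem_nth _ 0 (big_primes N) i i_s).
  by nia.
Qed.

Lemma odd_primorial_leq D : odd_primorial D <= 4 ^ D.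
Proof.
apply: leq_trans (primorial_leq D); rewrite [leqRHS](bigID (fun p => 2 < p)) /=.
by rewrite leq_pmulr // prodn_cond_gt0 // => p /andP[/prime_gt0].
Qed.

Lemma odd_primorial8 : odd_primorial 8 = 105.
Proof. by rewrite /odd_primorial unlock. Qed.

(* With [x = t * j], the admissible labels are those with at most [N / D]
   conflicts, where [D] is 8 as long as [x >= N / 8], and just above [N / x]
   otherwise. *)
Lemma exists_next_label n t j lam (s : seq nat) z (N := n * t.+1 + 2) :
  11 <= t -> 2 ^ lam.-1 < N.*2 <= 2 ^ lam -> 22 <= lam ->
  size (big_primes N) < j < n -> size s = j -> z \in s ->
  conf N z <= t * j.-1 -> 8 * conf N z <= N ->
  exists a, [/\ a < N, a \notin s, cop z a, conf N a <= t * j & 8 * conf N a <= N].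
Proof.
move=> t_ge lamP lam_ge /andP[q_j j_n] s_size z_s z_conf z_conf8.
have q_lam := size_big_primes_large lamP lam_ge; case/andP: lamP => lam_N N_lam.
have N_gt0 : 0 < N by rewrite /N addn2.
have lam2 : 2 ^ lam <= 4 * N by case: (lam) lam_ge lam_N => // l _ /=; rewrite expnS; lia.
have N_n : 12 * n <= N by rewrite /N; nia.
move: (size _) q_j q_lam => q q_j q_lam; clearbody N.
have pick D : 8 <= D -> 48 * odd_primorial D * (1 + D * lam) <= N ->
    (7 * N <= 4 * D * (count (fun a => D * conf N a <= N) (iota 0 N)) ->
     j + conf N z < count (fun a => D * conf N a <= N) (iota 0 N)) ->
    exists a, [/\ a < N, D * conf N a <= N, a \notin s & cop z a].
  move=> D_ge W_N F_gt; apply: exists_label => //; rewrite s_size; apply: F_gt.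
  exact: many_low_conf N_lam W_N.
have [x_large|x_small] := leqP N (8 * (t * j)).
  have [] := pick 8 => //.
  - by have := linear_leq_exp lam_ge; rewrite odd_primorial8; lia.
  (* [F >= 7N/32] exceeds [N/12 + N/8], while [j < n <= N/12] and [z] has at most [N/8]
     conflicts. *)
  - by move: (count _ _) => F; lia.
  move=> a [a_N a_conf a_s za]; exists a; split=> //; lia.
pose x := t * j; pose e := N %/ x.
have x_gt0 : 0 < x by rewrite muln_gt0; lia.
have e_ge : 8 <= e by rewrite leq_divRL // ltnW // mulnC.
have e_le : e * x <= N by exact: leq_divM.
have e_gt : N < e.+1 * x by rewrite -ltn_divLR.
(* [e * x <= N <= lam * q] and [x = t * j >= 11 * q]. *)
have e_lam : 11 * e <= lam.
  have qx : 11 * q <= x by apply: leq_mul => //; exact: ltnW.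
  by rewrite -(@leq_pmul2r x) //; have := leq_mul (leqnn lam) qx; lia.
have [] := pick e.+1.
- exact: leqW.
- have := exp_leq_exp e_ge e_lam; have := odd_primorial_leq e.+1.
  move: (odd_primorial _) (4 ^ _) => W V W_V H.
  rewrite -(@leq_pmul2l 4) //; apply: leq_trans lam2; apply: leq_trans H.
  by rewrite leq_mul2l /= -!mulnA leq_mul2l /= leq_mul2r W_V orbT.
- move: (count _ _) => F F_ge.
  (* [F >= 7N / 4(e+1)] with [N >= e * x] and [e / (e+1) >= 8/9]. This beats [j <= x / 11] plus the
     at most [x - t] conflicts of [z]. *)
  have F_x : 14 * x <= 9 * F.
    rewrite -(@leq_pmul2l e); last by lia.
    have : 8 * (e.+1 * F) <= 9 * (e * F) by rewrite !mulnA leq_mul2r; apply/orP; right; lia.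
    lia.
  have : 11 * j <= x by rewrite leq_mul2r t_ge orbT.
  have : t * j.-1 + t = x by rewrite -mulnSr prednK //; lia.
  lia.
move=> a [a_N a_conf a_s za]; exists a; split=> //.
  have : e.+1 * conf N a < e.+1 * x by exact: leq_ltn_trans a_conf e_gt.
  by rewrite ltn_mul2l => /andP[_ /ltnW].
by apply: leq_trans a_conf; rewrite leq_mul2r; apply/orP; right; lia.
Qed.

Lemma exists_spine n t (N := n * t.+1 + 2) : 0 < n -> 11 <= t ->
  exists2 s, size s = n & spine_prefix N t s.
Proof.
move=> n_gt0 t_ge; set q := size (big_primes N).
have N_gt1 : 1 < N by rewrite /N addn2.
have prefix_primes m : m <= q.+1 -> exists s, [/\ size s = m,
    spine_prefix N t s & {in s, forall a, conf N a <= 11}].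
  move=> m_q; exists (take m (0 :: big_primes N)); split.
  - exact: size_takel.
  - by apply: spine_prefix_primes; rewrite // ltnW.
  - by move=> a /mem_take; rewrite inE => /predU1P[->|/conf_big_primes]; rewrite ?conf0.
have [/prefix_primes[s [s_size s_good _]]|q_n] := leqP n q.+1; first by exists s.
pose lam := up_log 2 N.*2.
have lamP : 2 ^ lam.-1 < N.*2 <= 2 ^ lam by apply: up_log_bounds => //; lia.
have lam_ge : 22 <= lam.
  rewrite ltnNge; apply/negP => lam_le.
  by have := size_big_primes_medium N_gt1 lamP lam_le; rewrite -/q /N; nia.
(* [88 = 8 * 11], so the at most 11 conflicts of a big prime are within [N / 8]. *)
have N_large : 88 <= N.
  have : 2 ^ 9 <= 2 ^ lam.-1 by rewrite leq_exp2l //; lia.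
  by case/andP: lamP; lia.
suff build m : q.+1 <= m <= n -> exists s,
    [/\ size s = m, spine_prefix N t s & 8 * conf N (nth 0 s m.-1) <= N].
  by have [|s [s_size s_good _]] := build n; [lia | exists s].
elim: m => // m IH /andP[]; rewrite leq_eqVlt => /predU1P[<- _|q_m m_n].
  have [s [s_size s_good s_conf]] := prefix_primes q.+1 (leqnn _).
  exists s; split=> //; have : conf N (nth 0 s q) <= 11 by rewrite s_conf ?mem_nth ?s_size.
  by rewrite [q.+1.-1]/=; lia.
have [|s [s_size [s_u s_lt s0 s_cop s_conf] s_conf8]] := IH; first by lia.
have m_gt0 : 0 < m by lia.
have m1_m : m.-1 < size s by rewrite s_size prednK.
have [||a [a_N a_s za a_conf a_conf8]] := @exists_next_label n t m lam s _ t_ge lamP lam_ge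
  _ s_size (mem_nth 0 m1_m) _ s_conf8.
- by apply/andP; split.
- exact: s_conf m1_m.
exists (rcons s a); rewrite size_rcons s_size nth_rcons s_size ltnn eqxx; split=> //.
split.
- by rewrite rcons_uniq a_s.
- by move=> b; rewrite mem_rcons inE => /predU1P[->|/s_lt].
- by rewrite nth_rcons s_size m_gt0.
- move=> i; rewrite size_rcons s_size ltnS => i_m; rewrite !nth_rcons s_size i_m.
  have [i1_m|m_i1|i1_m] := ltngtP i.+1 m.
  + by apply: s_cop; rewrite s_size.
  + by lia.
  + by move: za; rewrite -i1_m.
- move=> i; rewrite size_rcons s_size nth_rcons s_size => i_m.
  have [i_lt|m_i|->] := ltngtP i m => //; last by lia.
  by apply: s_conf; rewrite s_size.
Qed.

Theorem theorem4p6 (n t : nat) : 1 <= n -> 1 <= t ->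
  odd_prime (@caterpillar_adj n t).
Proof.
move=> n_gt0 t_gt0; have [t_le|t_gt] := leqP t 10.
  by apply: odd_prime_small; rewrite ?t_gt0.
have [s s_size [s_u s_lt s0 s_cop s_conf]] := exists_spine n_gt0 t_gt.
rewrite s_size in s_cop s_conf.
exact: odd_prime_of_spine n_gt0 s_size s_u s0 s_lt s_cop s_conf.
Qed.
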